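(* Let $\Delta=(N_1,\dots,N_l)$ be a partition of $n$ with $N_1\le\dots\le N_l\le p$ and $z\in M(d,n;\mathbb{F}_q)$. (i) For $g\in GL_d(\mathbb{F}_q)$, the map $L_g\colon X_{\Delta,z}\to X_{\Delta,gz}$, $((t_i,u_i),s)\mapsto((t_i,u_i),sg^{-1})$, is an isomorphism. (ii) For $h=\mathrm{diag}(h_1,\dots,h_l)\in H_\Delta$ with $h_i=[h_{(i,0)},\dots,h_{(i,N_i-1)}]\in J(N_i)$, the map $R_h\colon X_{\Delta,z}\otimes\mathbb{k}'\to X_{\Delta,zh}\otimes\mathbb{k}'$, $((t_i,u_i),s)\mapsto((t'_i,u'_i),s)$ with $t'_i=\sqrt[N]{h_{(i,0)}}\,t_i$ and $u'_{(i,j)}=u_{(i,j)}+r(\theta_j(h_i))$, is an isomorphism, where $\mathbb{k}'=\mathbb{F}_{q^N}$ if $\Delta=(1,\dots,1)$ and $\mathbb{k}'=\mathbb{F}_{q^{pN}}$ otherwise.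
   Context: $q$ is a power of a prime $p$, $N=q-1$. For $m\ge1$ let $\Lambda$ be the $m\times m$ matrix with $1$'s on the superdiagonal, $[h_0,\dots,h_{m-1}]=\sum_i h_i\Lambda^i$, $J(m)=\{[h_0,\dots,h_{m-1}]:h_0\in\mathbb{F}_q^*,h_i\in\mathbb{F}_q\}$. For $x=(x_0,x_1,\dots)$, $X_j=x_j/x_0$, $\theta_i(x)=\sum_{k_1+2k_2+\dots+ik_i=i,\,k_j\ge0}(-1)^{k_1+\dots+k_i-1}\frac{(k_1+\dots+k_i-1)!}{k_1!\cdots k_i!}X_1^{k_1}\cdots X_i^{k_i}$, $\overline\theta_i(x)=x_0^i\theta_i(x)$, $\theta_i([h_0,\dots,h_{m-1}])=\theta_i(h_0,\dots,h_i)$. $H_\Delta=\{\mathrm{diag}(h_1,\dots,h_l):h_i\in J(N_i)\}$. Write $z=(z^{(1)},\dots,z^{(l)})$, $z^{(i)}=(z^{(i)}_0,\dots,z^{(i)}_{N_i-1})$ consecutive column blocks; for a row vector $s\in\mathbb{F}_q^d$, $sz^{(i)}$ denotes $(sz^{(i)}_0,\dots,sz^{(i)}_{N_i-1})$. $X_{\Delta,z}$ is the affine variety over $\mathbb{F}_q$ in coordinates $t_i$ ($1\le i\le l$), $u_i=(u_{(i,1)},\dots,u_{(i,N_i-1)})$, $s=(s_1,\dots,s_d)$, defined by $t_i^N=sz^{(i)}_0$, $t_i^{Nj}(u_{(i,j)}^q-u_{(i,j)})=\overline\theta_j(sz^{(i)})$ ($1\le j\le N_i-1$), $t_i\ne0$.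 For each $a\in\mathbb{F}_q^*$ a fixed $N$-th root $\sqrt[N]{a}\in\mathbb{F}_{q^N}$ is chosen (with $\sqrt[N]{1}=1$); $r(1)$ is a fixed root of $x^q-x=1$ in $\mathbb{F}_{q^p}$ and $r(t)=t\cdot r(1)$ for $t\in\mathbb{F}_q$. For a variety $X$ over $\mathbb{F}_q$ and an extension $\mathbb{k}'/\mathbb{F}_q$, $X\otimes\mathbb{k}'=X\times_{\mathrm{Spec}\,\mathbb{F}_q}\mathrm{Spec}\,\mathbb{k}'$. *)

(* Defs.v *)
From HB Require Import structures.
From mathcomp Require Import all_boot all_order all_algebra.

Set Implicit Arguments.
Unset Strict Implicit.
Unset Printing Implicit Defensive.

Import GRing.Theory.
Local Open Scope ring_scope.

Record kalgebra (k : fieldType) := KAlgebra {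
  kalg_ring :> comUnitRingType;
  kalg_str : {rmorphism k -> kalg_ring}
}.

Record khom (k : fieldType) (A B : kalgebra k) := KHom {
  khom_fun :> {rmorphism A -> B};
  khomP : forall c, khom_fun (kalg_str A c) = kalg_str B c
}.

(* A subscheme X of the affine space with coordinates indexed by V is given by
   its sets X(A) of A-points, a subset of A^V for every commutative k-algebra
   A, functorially in A. *)
Record kscheme (k : fieldType) (V : Type) := KScheme {
  kpt :> forall A : kalgebra k, (V -> A) -> Prop;
  kptP : forall (A B : kalgebra k) (f : khom A B) (x : V -> A),
    kpt x -> kpt (fun v => f (x v))
}.

Section Morphisms.
Variables (k : fieldType) (V W : Type).

Definition kmap (V1 V2 : Type) := forall A : kalgebra k, (V1 -> A) -> (V2 -> A).

(* A morphism X -> Y is a family of maps X(A) -> Y(A) that is natural in A;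
   the values of phi outside X are irrelevant. *)
Definition is_morphism (V1 V2 : Type) (X : kscheme k V1) (Y : kscheme k V2)
    (phi : kmap V1 V2) : Prop :=
  (forall (A : kalgebra k) (x : V1 -> A), X A x -> Y A (phi A x)) /\
  (forall (A B : kalgebra k) (f : khom A B) (x : V1 -> A), X A x ->
     phi B (fun v => f (x v)) =1 (fun w => f (phi A x w))).

Definition is_isomorphism (X : kscheme k V) (Y : kscheme k W)
    (phi : kmap V W) : Prop :=
  is_morphism X Y phi /\
  exists psi : kmap W V,
    [/\ is_morphism Y X psi,
        forall (A : kalgebra k) (x : V -> A), X A x -> psi A (phi A x) =1 x
      & forall (A : kalgebra k) (y : W -> A), Y A y -> phi A (psi A y) =1 y].

End Morphisms.

Section BaseChange.
Variables (k K : fieldType) (iota : {rmorphism k -> K}).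

Definition restrict (A : kalgebra K) : kalgebra k :=
  @KAlgebra k A (kalg_str A \o iota).

Lemma restrict_homP (A B : kalgebra K) (f : khom A B) (c : k) :
  f (kalg_str (restrict A) c) = kalg_str (restrict B) c.
Proof. exact: khomP. Qed.

Definition restrict_hom (A B : kalgebra K) (f : khom A B) :
  khom (restrict A) (restrict B) :=
  @KHom k (restrict A) (restrict B) f (restrict_homP f).

(* The fibre product of X and Spec K over Spec k: its points in a K-algebra
   are the points of X in the underlying k-algebra. *)
Definition base_change (V : Type) (X : kscheme k V) : kscheme K V :=
  @KScheme K V (fun A x => X (restrict A) x)
    (fun A B f x => @kptP k V X _ _ (restrict_hom f) x).

End BaseChange.

(* The tuples (k_1, .., k_i) with k_1 + 2 k_2 + .. + i k_i = i are the
   functions k with k_(j+1) = k j; the constraint forces k_j <= i.  The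
   rational coefficients are read in F: for i < p, with p the characteristic,
   their denominators are invertible there.  Meaningful for i >= 1 and x 0
   invertible. *)
Definition theta (F : fieldType) (A : comUnitRingType)
    (str : {rmorphism F -> A}) (i : nat) (x : nat -> A) : A :=
  \sum_(k : {ffun 'I_i -> 'I_i.+1} | (\sum_(j < i) j.+1 * k j == i)%N)
     str ((-1) ^+ (\sum_(j < i) k j).-1
          * ((\sum_(j < i) k j).-1)`!%:R / (\prod_(j < i) (k j)`!)%:R)
     * \prod_(j < i) (x j.+1 / x 0%N) ^+ k j.

Definition thetabar (F : fieldType) (A : comUnitRingType)
    (str : {rmorphism F -> A}) (i : nat) (x : nat -> A) : A :=
  x 0%N ^+ i * theta str i x.

Lemma thetabar_rmorph (F : fieldType) (A B : comUnitRingType)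
    (sA : {rmorphism F -> A}) (sB : {rmorphism F -> B})
    (f : {rmorphism A -> B}) (i : nat) (x : nat -> A) (y : nat -> B) :
  (forall c, f (sA c) = sB c) -> x 0%N \is a GRing.unit ->
  (forall k, y k = f (x k)) ->
  thetabar sB i y = f (thetabar sA i x).
Proof.
move=> fs x0 yE; rewrite /thetabar /theta yE rmorphM rmorphXn rmorph_sum.
congr (_ * _); apply: eq_bigr => k _; rewrite [RHS]rmorphM fs.
congr (_ * _); rewrite (rmorph_prod f); apply: eq_bigr => j _.
by rewrite yE rmorphXn rmorphM rmorphV.
Qed.

(* The entries of a row vector as a sequence, extended by 0. *)
Definition rseq (A : nmodType) (m : nat) (v : 'rV[A]_m) (k : nat) : A :=
  oapp (fun i : 'I_m => v 0 i) 0 (insub k).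

Lemma rseq_map (A B : nmodType) (f : A -> B) m (v : 'rV[A]_m) k :
  f 0 = 0 -> rseq (map_mx f v) k = f (rseq v k).
Proof. by rewrite /rseq => f0; case: insub => //= i; rewrite mxE. Qed.

Definition shift_mx (F : fieldType) (m : nat) : 'M[F]_m :=
  \matrix_(i, j) (j == i.+1 :> nat)%:R.

Definition bracket (F : fieldType) (m : nat) (c : 'rV[F]_m) : 'M[F]_m :=
  \sum_(i < m) c 0 i *: shift_mx F m ^+ i.

Definition Jgroup (F : fieldType) (m : nat) (A : 'M[F]_m) : Prop :=
  exists2 c : 'rV[F]_m, rseq c 0 != 0 & A = bracket c.

(* Ct i is t_i, Cu i j is u_(i, j+1), Cs a is s_a. *)
Inductive coord (l : nat) (Delta : 'I_l -> nat) (d : nat) :=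
  | Ct of 'I_l
  | Cu (i : 'I_l) of 'I_(Delta i).-1
  | Cs of 'I_d.
Arguments Ct {l Delta d} i.
Arguments Cu {l Delta d} i j.
Arguments Cs {l Delta d} a.

Section Variety.
Variables (F : finFieldType) (l : nat) (Delta : 'I_l -> nat) (d : nat).

Definition srow (A : comUnitRingType) (x : coord Delta d -> A) : 'rV[A]_d :=
  \row_a x (Cs a).

(* The sequence s z^(i). *)
Definition sz (A : kalgebra F) (z : 'M[F]_(d, \sum_i Delta i))
    (x : coord Delta d -> A) (i : 'I_l) : nat -> A :=
  rseq (srow x *m map_mx (kalg_str A) (submxrow z i)).

Definition Xpt (z : 'M[F]_(d, \sum_i Delta i)) (A : kalgebra F)
    (x : coord Delta d -> A) : Prop :=
  forall i : 'I_l,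
    [/\ x (Ct i) \is a GRing.unit,
        x (Ct i) ^+ (#|F|.-1) = sz z x i 0
      & forall j : 'I_(Delta i).-1,
          x (Ct i) ^+ (#|F|.-1 * j.+1) * (x (Cu i j) ^+ #|F| - x (Cu i j))
          = thetabar (kalg_str A) j.+1 (sz z x i)].

Lemma sz_hom (A B : kalgebra F) (f : khom A B) z (x : coord Delta d -> A) i k :
  sz z (fun v => f (x v)) i k = f (sz z x i k).
Proof.
rewrite /sz -rseq_map ?rmorph0 // map_mxM; congr (rseq (_ *m _) k).
  by apply/rowP => a; rewrite !mxE.
by apply/matrixP => a b; rewrite !mxE /= khomP.
Qed.

Lemma XptP z (A B : kalgebra F) (f : khom A B) (x : coord Delta d -> A) :
  Xpt z x -> Xpt z (fun v => f (x v)).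
Proof.
move=> Xx i; have [tU t0 tu] := Xx i; split; first exact: rmorph_unit.
  by rewrite sz_hom -t0 rmorphXn.
move=> j; rewrite (thetabar_rmorph _ (khomP f) _ (sz_hom f z x i)).
  by rewrite -tu rmorphM rmorphB !rmorphXn.
by rewrite -t0 unitrX.
Qed.

Definition Xvar (z : 'M[F]_(d, \sum_i Delta i)) : kscheme F (coord Delta d) :=
  @KScheme F (coord Delta d) (@Xpt z) (@XptP z).

Definition Lmap (g : 'M[F]_d) : kmap F (coord Delta d) (coord Delta d) :=
  fun A x v => match v with
  | Ct i => x (Ct i)
  | Cu i j => x (Cu i j)
  | Cs a => (srow x *m map_mx (kalg_str A) (invmx g)) 0 a
  end.

Section RightAction.
Variables (K : fieldType) (iota : {rmorphism F -> K}).

(* root a is the chosen N-th root of a, r1 stands for r(1), and c i is the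
   sequence of coefficients of h_i. *)
Definition Rmap (root : F -> K) (r1 : K) (c : forall i, 'rV[F]_(Delta i)) :
    kmap K (coord Delta d) (coord Delta d) :=
  fun A x v => match v with
  | Ct i => kalg_str A (root (rseq (c i) 0)) * x (Ct i)
  | Cu i j => x (Cu i j)
              + kalg_str A (iota (theta idfun j.+1 (rseq (c i))) * r1)
  | Cs a => x (Cs a)
  end.

(* A choice of N-th roots in F_(q^N), which is the subfield of K fixed by the
   q^N-power map. *)
Definition Nth_root_choice (root : F -> K) : Prop :=
  root 1 = 1 /\
  forall a : F, a != 0 ->
    root a ^+ (#|F|.-1) = iota a /\ root a ^+ (#|F| ^ #|F|.-1) = root a.

(* A root of x^q - x = 1 in F_(q^p). *)
Definition AS_root (p : nat) (r1 : K) : Prop :=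
  r1 ^+ #|F| - r1 = 1 /\ r1 ^+ (#|F| ^ p) = r1.

End RightAction.
End Variety.

(* Main.v *)
(* For 0 < i < p, theta_i(x) is the coefficient of T^i in log (sum_k X_k T^k),
   with X_0 = 1: this is the multinomial expansion of the powers in the
   logarithm series.  Since log turns products into sums, theta_i is additive
   for the multiplication of truncated power series, which is how h in J(m)
   acts on row vectors; modulo powers of T this follows from the logarithmic
   derivative, f (log f)' = f'.

   The equations of X_(Delta,z) say that t_i^N = s z^(i)_0 and
   u_(i,j)^q - u_(i,j) = theta_j(s z^(i)).  Replacing z by z h multiplies
   s z^(i)_0 by h_(i,0) and adds theta_j(h_i) to theta_j(s z^(i)), which is
   compensated by an N-th root of h_(i,0) and an Artin-Schreier root of
   theta_j(h_i). *)
Require Import Defs.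
From HB Require Import structures.
From mathcomp Require Import all_boot all_order all_algebra.
From mathcomp Require Import pgroup finfield.

Set Implicit Arguments.
Unset Strict Implicit.
Unset Printing Implicit Defensive.

Import GRing.Theory.
Local Open Scope ring_scope.

Local Notation coord := Defs.coord.

Lemma dvdn_leq_fact m n : (m <= n)%N -> (m`! %| n`!)%N.
Proof. by move=> le_mn; rewrite -(bin_fact le_mn) dvdn_mull ?dvdn_mulr. Qed.

Lemma natr_dvdn_unit (R : comUnitRingType) m n :
  (m %| n)%N -> (n%:R : R) \is a GRing.unit -> (m%:R : R) \is a GRing.unit.
Proof. by case/dvdnP=> k ->; rewrite natrM unitrM => /andP[]. Qed.

Lemma natr_fact_neq0 (R : idomainType) p n :
  p \in [pchar R] -> (n < p)%N -> n`!%:R != 0 :> R.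
Proof.
move=> pR; elim: n => [|n IHn] lt_np; first exact: oner_neq0.
by rewrite factS natrM mulf_neq0 ?IHn 1?ltnW // -(dvdn_pcharf pR) gtnNdvd.
Qed.

Definition eqmodX (R : nzSemiRingType) (n : nat) (p q : {poly R}) : Prop :=
  forall k, (k < n)%N -> p`_k = q`_k.

Local Notation "p = q %[modX n ]" := (eqmodX n p q)
  (at level 70, q at next level, format "p  =  q  %[modX  n ]") : ring_scope.

Section TruncatedCongruence.
Variable R : nzSemiRingType.
Implicit Types (p q : {poly R}) (n : nat).

Lemma eqmodX_sym n p q : p = q %[modX n] -> q = p %[modX n].
Proof. by move=> pq k lt_kn; rewrite pq. Qed.

Lemma eqmodX_trans n p q r :
  p = q %[modX n] -> q = r %[modX n] -> p = r %[modX n].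
Proof. by move=> pq qr k lt_kn; rewrite pq ?qr. Qed.

Lemma eqmodXD n p1 p2 q1 q2 :
    p1 = p2 %[modX n] -> q1 = q2 %[modX n] -> p1 + q1 = p2 + q2 %[modX n].
Proof. by move=> p12 q12 k lt_kn; rewrite !coefD p12 ?q12. Qed.

Lemma eqmodXM n p1 p2 q1 q2 :
    p1 = p2 %[modX n] -> q1 = q2 %[modX n] -> p1 * q1 = p2 * q2 %[modX n].
Proof.
move=> p12 q12 k lt_kn; rewrite !coefM; apply: eq_bigr => j _.
have le_jk : (j <= k)%N by rewrite -ltnS.
by rewrite p12 ?q12 // (leq_ltn_trans _ lt_kn) ?leq_subr.
Qed.

Lemma eqmodX_deriv n p q :
  p = q %[modX n.+1] -> p^`() = q^`() %[modX n].
Proof. by move=> pq k lt_kn; rewrite !coef_deriv pq. Qed.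

Lemma eqmodX_exp0 n p : p`_0 = 0 -> p ^+ n = 0 %[modX n].
Proof.
elim/poly_ind: p => [|p c _]; first by rewrite expr0n; case: n => // n _ k.
rewrite coefD coefMX coefC add0r => ->; rewrite addr0 exprMn_comm => [k lt_kn|].
  by rewrite coefMXn lt_kn coef0.
exact: commr_polyX.
Qed.

End TruncatedCongruence.

Section TruncatedCancellation.
Variable R : comUnitRingType.
Implicit Types (f p q : {poly R}) (n : nat).

Lemma eqmodX_mulIl n f p q : f`_0 \is a GRing.unit ->
  f * p = f * q %[modX n] -> p = q %[modX n].
Proof.
move=> f0 fpq; elim/ltn_ind=> k IHk lt_kn; have := fpq k lt_kn.
rewrite !coefM !big_ord_recl subn0.
under eq_bigr => j _.
  have lt_subk : (k - lift ord0 j < k)%N.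
    by rewrite ltn_subrL (leq_ltn_trans _ (ltn_ord j)).
  rewrite (IHk _ lt_subk (ltn_trans lt_subk lt_kn)); over.
by move/addIr/(mulrI f0).
Qed.

Lemma eqmodX_deriv_inj n p q : (n`!%:R : R) \is a GRing.unit ->
  p`_0 = q`_0 -> p^`() = q^`() %[modX n] -> p = q %[modX n.+1].
Proof.
move=> fact_unit pq0 pq' [//|k] lt_kn; have := pq' k lt_kn.
rewrite !coef_deriv -(mulr_natr p`_k.+1) -(mulr_natr q`_k.+1); apply: mulIr.
by apply: natr_dvdn_unit fact_unit; rewrite dvdn_fact.
Qed.

End TruncatedCancellation.

Section DividedPowers.
Variables (R : comUnitRingType) (A : comAlgType R).
Implicit Types (a b : A) (n : nat).

Definition divpow n a : A := n`!%:R^-1 *: a ^+ n.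

Lemma divpowD n a b : (n`!%:R : R) \is a GRing.unit ->
  divpow n (a + b) = \sum_(k < n.+1) divpow k a * divpow (n - k) b.
Proof.
move=> fact_unit; rewrite /divpow addrC exprDn scaler_sumr.
apply: eq_bigr => k _.
rewrite -scaler_nat scalerA -scalerAl -scalerAr scalerA mulrC.
congr (_ *: _); last by rewrite mulrC.
move: fact_unit; rewrite -(bin_fact (leq_ord k)) !natrM !unitrM.
case/and3P=> C_unit k_unit nk_unit.
by rewrite !invrM ?unitrM ?k_unit // mulrC divrK // mulrC.
Qed.

Definition truncated_exp M a : {poly A} := \poly_(k < M.+1) divpow k a.

Lemma prod_truncated_exp M (I : Type) (s : seq I) (a : I -> A) :
  (M`!%:R : R) \is a GRing.unit ->
  \prod_(j <- s) truncated_exp M (a j) = truncated_exp M (\sum_(j <- s) a j)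
    %[modX M.+1].
Proof.
move=> fact_unit; elim: s => [|j s IHs].
  rewrite !big_nil => k lt_kM; rewrite coef_poly lt_kM coef1 /divpow.
  by case: k {lt_kM} => [|k]; rewrite ?expr0n ?scaler0 // fact0 invr1 scale1r.
rewrite !big_cons; apply: eqmodX_trans (eqmodXM _ IHs) _ => // k lt_kM.
rewrite coefM coef_poly lt_kM divpowD; last first.
  by apply: natr_dvdn_unit fact_unit; apply: dvdn_leq_fact.
apply: eq_bigr => i _; rewrite !coef_poly !ifT //.
  by rewrite (leq_ltn_trans (leq_subr _ _)).
by rewrite (leq_trans (ltn_ord i)).
Qed.

Lemma divpow_sum n M m (a : 'I_m -> A) :
    (n <= M)%N -> (M`!%:R : R) \is a GRing.unit ->
  divpow n (\sum_(j < m) a j) =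
  \sum_(k : {ffun 'I_m -> 'I_M.+1} | (\sum_(j < m) k j == n)%N)
     \prod_(j < m) divpow (k j) (a j).
Proof.
move=> le_nM fact_unit.
have := prod_truncated_exp (index_enum 'I_m) a fact_unit le_nM.
rewrite coef_poly ltnS le_nM => <-.
under eq_bigr do rewrite /truncated_exp poly_def.
rewrite bigA_distr_bigA coef_sum [RHS]big_mkcond; apply: eq_bigr => k _ /=.
rewrite scaler_prod prodrXr coefZ coefXn eq_sym.
by case: eqP; rewrite ?mulr1 ?mulr0.
Qed.

End DividedPowers.

Section TruncatedLogarithm.
Variables (R : comUnitRingType) (i : nat).
Hypothesis fact_unit : (i`!%:R : R) \is a GRing.unit.
Implicit Types f g h : {poly R}.

Definition truncated_log f : {poly R} :=
  \sum_(n < i) ((-1) ^+ n / n.+1%:R) *: (f - 1) ^+ n.+1.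

Lemma coef0_truncated_log f : f`_0 = 1 -> (truncated_log f)`_0 = 0.
Proof.
move=> f0; rewrite coef_sum big1 // => n _.
by rewrite coefZ exprS coef0M coefB coef1 f0 subrr mul0r mulr0.
Qed.

Lemma deriv_truncated_log f :
  (truncated_log f)^`() = f^`() * \sum_(n < i) (1 - f) ^+ n.
Proof.
rewrite /truncated_log raddf_sum mulr_sumr; apply: eq_bigr => n _ /=.
rewrite derivZ deriv_exp derivB derivC subr0 /= -scaler_nat scalerA divrK.
  by rewrite -mul_polyC rmorph_sign -(opprB f) (exprNn (f - 1)) mulrCA.
by apply: natr_dvdn_unit fact_unit; rewrite dvdn_fact ?ltn_ord.
Qed.

Lemma mul_deriv_truncated_log f :
  f`_0 = 1 -> f * (truncated_log f)^`() = f^`() %[modX i].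
Proof.
move=> f0 k lt_ki; rewrite deriv_truncated_log mulrCA.
have -> : f * (\sum_(n < i) (1 - f) ^+ n) = 1 - (1 - f) ^+ i.
  by rewrite -[RHS]opprB subrX1 -mulNr opprB subKr.
have exp0 : (1 - f) ^+ i = 0 %[modX i].
  by apply: eqmodX_exp0; rewrite coefB coef1 f0 subrr.
rewrite mulrBr mulr1 coefB (eqmodXM (fun _ _ => erefl) exp0) //.
by rewrite mulr0 coef0 subr0.
Qed.

Lemma truncated_logM f g h : f`_0 = 1 -> g`_0 = 1 -> h = f * g %[modX i.+1] ->
  truncated_log h = truncated_log f + truncated_log g %[modX i.+1].
Proof.
move=> f0 g0 h_fg.
have h0 : h`_0 = 1 by rewrite h_fg // coef0M f0 g0 mulr1.
apply: eqmodX_deriv_inj fact_unit _ _.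
  by rewrite coefD !coef0_truncated_log ?addr0.
apply: (@eqmodX_mulIl _ _ h); first by rewrite h0 unitr1.
apply: eqmodX_trans (mul_deriv_truncated_log h0) _.
apply: eqmodX_trans (eqmodX_deriv h_fg) _; apply: eqmodX_sym.
have h_fgW : h = f * g %[modX i] by move=> k /ltnW; apply: h_fg.
apply: eqmodX_trans (eqmodXM h_fgW (fun _ _ => erefl)) _.
rewrite derivD derivM mulrDr mulrAC -[X in _ + X]mulrA.
apply: eqmodXD; apply: eqmodXM => //; exact: mul_deriv_truncated_log.
Qed.

End TruncatedLogarithm.

Section Partitions.
Variables (m M : nat).
Implicit Types k : {ffun 'I_m -> 'I_M}.

(* k encodes the partition with k j parts equal to j + 1. *)
Definition nparts k : nat := (\sum_(j < m) k j)%N.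
Definition weight k : nat := (\sum_(j < m) j.+1 * k j)%N.

Lemma nparts_gt0 k : (0 < weight k)%N -> (0 < nparts k)%N.
Proof.
rewrite !lt0n; apply: contra; rewrite !sum_nat_eq0 => /forallP k0.
by apply/forallP => j; rewrite muln_eq0 (k0 j).
Qed.

Lemma leq_nparts_weight k : (nparts k <= weight k)%N.
Proof. by apply: leq_sum => j _; apply: leq_pmull. Qed.

Lemma inord_nparts_eq n (j : 'I_n.+1) k : weight k = n.+1 ->
  (inord (nparts k).-1 == j) = (nparts k == j.+1).
Proof.
move=> wk; have k_gt0 : (0 < nparts k)%N by rewrite nparts_gt0 ?wk.
have le_kn : (nparts k <= n.+1)%N by rewrite -wk leq_nparts_weight.
by rewrite -val_eqE /= inordK ?prednK // -eqSS prednK.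
Qed.

End Partitions.

Lemma coef_divpow_sumX (R : comUnitRingType) n M m i (a : 'I_m -> R) :
    (n <= M)%N -> (M`!%:R : R) \is a GRing.unit ->
  (divpow n (\sum_(j < m) a j *: 'X^(j.+1)))`_i =
  \sum_(k : {ffun 'I_m -> 'I_M.+1} | (nparts k == n) && (weight k == i))
     (\prod_(j < m) (k j)`!)%:R^-1 * \prod_(j < m) a j ^+ k j.
Proof.
move=> le_nM fact_unit; rewrite (divpow_sum _ le_nM fact_unit) coef_sum.
rewrite [RHS]big_mkcondr; apply: eq_bigr => k _ /=.
rewrite scaler_prod natr_prod prodrV => [|j _]; last first.
  by apply: natr_dvdn_unit fact_unit; apply: dvdn_leq_fact; rewrite -ltnS.
under [X in _ *: X]eq_bigr do rewrite exprZn -exprM.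
rewrite scaler_prod prodrXr !coefZ coefXn eq_sym /weight.
by case: eqP; rewrite ?mulr1 ?mulr0.
Qed.

Definition convol (R : pzSemiRingType) (x y : nat -> R) (k : nat) : R :=
  \sum_(a < k.+1) x a * y (k - a)%N.

Section Theta.
Variables (F : fieldType) (A : comUnitRingType) (str : {rmorphism F -> A}).
Variable i : nat.
Hypothesis fact_unit : (i.+1`!%:R : A) \is a GRing.unit.
Implicit Types x y w : nat -> A.

Definition normalized_poly x : {poly A} := \poly_(k < i.+2) (x k / x 0%N).

Lemma coef0_normalized_poly x :
  x 0%N \is a GRing.unit -> (normalized_poly x)`_0 = 1.
Proof. by move=> x0; rewrite coef_poly divrr. Qed.

Lemma normalized_polyB1 x : x 0%N \is a GRing.unit ->
  normalized_poly x - 1 = \sum_(j < i.+1) (x j.+1 / x 0%N) *: 'X^(j.+1).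
Proof.
move=> x0; rewrite /normalized_poly poly_def big_ord_recl divrr // scale1r.
by rewrite addrAC subrr add0r.
Qed.

Lemma theta_truncated_log x : x 0%N \is a GRing.unit ->
  theta str i.+1 x = (truncated_log i.+1 (normalized_poly x))`_i.+1.
Proof.
move=> x0; rewrite coef_sum /theta.
pose idx (k : {ffun 'I_i.+1 -> 'I_i.+2}) : 'I_i.+1 := inord (nparts k).-1.
rewrite (partition_big idx xpredT) //; apply: eq_bigr => n _.
transitivity ((-1) ^+ n * n`!%:R
    * (divpow n.+1 (normalized_poly x - 1))`_i.+1); last first.
  rewrite !coefZ mulrA; congr (_ * _).
  have := natr_dvdn_unit (dvdn_leq_fact (ltn_ord n)) fact_unit.
  rewrite factS natrM unitrM => /andP[succ_unit nfact_unit].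
  by rewrite invrM // mulrA mulrK.
rewrite normalized_polyB1 // (coef_divpow_sumX _ _ (ltn_ord n) fact_unit).
rewrite mulr_sumr; apply: eq_big => [k|k /andP[/eqP wk]].
  by rewrite andbC; apply: andb_id2r => /eqP /inord_nparts_eq.
rewrite (inord_nparts_eq _ wk) /nparts => /eqP ->.
by rewrite fmorph_div rmorphM rmorph_sign !rmorph_nat mulrA.
Qed.

Lemma theta_convol x y w :
    x 0%N \is a GRing.unit -> y 0%N \is a GRing.unit ->
    (forall k, (k <= i.+1)%N -> w k = convol x y k) ->
  theta str i.+1 w = theta str i.+1 x + theta str i.+1 y.
Proof.
move=> x0 y0 w_xy; have w0E : w 0%N = x 0%N * y 0%N.
  by rewrite w_xy // /convol big_ord1.
have w0 : w 0%N \is a GRing.unit by rewrite w0E unitrM x0.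
rewrite !theta_truncated_log // -coefD.
apply: (truncated_logM fact_unit) => //; try exact: coef0_normalized_poly.
move=> k lt_ki; rewrite coefM coef_poly lt_ki w_xy // mulr_suml.
apply: eq_bigr => a _; have le_ak : (a <= k)%N by rewrite -ltnS.
rewrite !coef_poly (leq_ltn_trans le_ak) // (leq_ltn_trans (leq_subr _ _)) //.
by rewrite w0E invrM // [(y 0%N)^-1 * _]mulrC mulrACA.
Qed.

End Theta.

Lemma theta_rmorph (F : fieldType) (A B : comUnitRingType)
    (sA : {rmorphism F -> A}) (sB : {rmorphism F -> B})
    (f : {rmorphism A -> B}) (i : nat) (x : nat -> A) (y : nat -> B) :
  (forall c, f (sA c) = sB c) -> x 0%N \is a GRing.unit ->
  (forall k, y k = f (x k)) ->
  theta sB i y = f (theta sA i x).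
Proof.
move=> fs x0 yE; have y0 : y 0%N \is a GRing.unit by rewrite yE rmorph_unit.
apply: (mulrI (unitrX i y0)); have := thetabar_rmorph i fs x0 yE.
by rewrite /thetabar rmorphM rmorphXn -yE.
Qed.

Section Bracket.
Variables (F : fieldType) (m : nat).
Implicit Types (c : 'rV[F]_m) (a b : 'I_m).

Lemma rseq_ord (A : nmodType) (v : 'rV[A]_m) a : rseq v a = v 0 a.
Proof. by rewrite /rseq valK. Qed.

Lemma exp_shift_mxE n a b : (shift_mx F m ^+ n) a b = (b == a + n :> nat)%N%:R.
Proof.
elim: n a => [|n IHn] a; first by rewrite expr0 mxE addn0 eq_sym.
rewrite exprS mxE addnS; have [lt_am|le_ma] := ltnP a.+1 m; last first.
  rewrite big1 ?(ltn_eqF _) //.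
    by rewrite (leq_trans (ltn_ord b)) // (leq_trans le_ma) // ltnS leq_addr.
  by move=> j _; rewrite mxE ltn_eqF ?mul0r // (leq_trans (ltn_ord j)).
rewrite (bigD1 (Ordinal lt_am)) //= mxE eqxx mul1r IHn addSn.
rewrite big1 ?addr0 // => j; rewrite mxE -val_eqE /= => /negPf ->.
by rewrite mul0r.
Qed.

Lemma bracketE c a b : bracket c a b = if (a <= b)%N then rseq c (b - a) else 0.
Proof.
rewrite /bracket summxE; case: leqP => [le_ab|lt_ba]; last first.
  rewrite big1 // => j _; rewrite mxE exp_shift_mxE ltn_eqF ?mulr0 //.
  by rewrite (leq_trans lt_ba) ?leq_addr.
have lt_bam : (b - a < m)%N by rewrite (leq_ltn_trans (leq_subr _ _)).
rewrite (bigD1 (Ordinal lt_bam)) //= mxE exp_shift_mxE subnKC // eqxx mulr1.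
rewrite -rseq_ord /= big1 ?addr0 // => j; rewrite -val_eqE /= => j_neq.
rewrite mxE exp_shift_mxE (_ : _ == _ = false) ?mulr0 //.
by apply: contraNF j_neq => /eqP ->; rewrite addKn.
Qed.

Lemma rseq_mul_bracket (A : comUnitRingType) (str : {rmorphism F -> A})
    (v : 'rV[A]_m) c k : (k < m)%N ->
  rseq (v *m map_mx str (bracket c)) k = convol (rseq v) (str \o rseq c) k.
Proof.
move=> lt_km; rewrite (rseq_ord _ (Ordinal lt_km)) mxE /convol.
rewrite (big_ord_widen m (fun j => rseq v j * str (rseq c (k - j)))) //.
rewrite [RHS]big_mkcond; apply: eq_bigr => j _; rewrite mxE bracketE /= ltnS.
by rewrite -rseq_ord; case: leqP => // _; rewrite rmorph0 mulr0.
Qed.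

Lemma Jgroup_bracket_neq0 c : (0 < m)%N -> Jgroup (bracket c) -> rseq c 0 != 0.
Proof.
move=> m_gt0 [c' c'0 /matrixP/(_ (Ordinal m_gt0) (Ordinal m_gt0))].
by rewrite !bracketE /= => ->.
Qed.

End Bracket.

Lemma card_pchar_nat (F : finFieldType) (A : comNzRingType)
    (str : {rmorphism F -> A}) : [pchar A].-nat #|F|.
Proof.
have [p _ pF] := finPcharP F.
rewrite (eq_pnat _ (pcharf_eq (rmorph_pchar str pF))).
by have := pprimeChar_pgroup pF; rewrite /pgroup cardsT.
Qed.

Lemma card_finField_pred_gt0 (F : finFieldType) : (0 < #|F|.-1)%N.
Proof. by rewrite -subn1 subn_gt0 finNzRing_gt1. Qed.

Definition natural_kmap (k : fieldType) (V W : Type) (phi : kmap k V W) :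
    Prop :=
  forall (A B : kalgebra k) (f : khom A B) (x : V -> A),
    phi B (fun v => f (x v)) =1 (fun w => f (phi A x w)).

Lemma inverse_kmaps_isomorphism (k : fieldType) (V W : Type)
    (X : kscheme k V) (Y : kscheme k W) (phi : kmap k V W) (psi : kmap k W V) :
    natural_kmap phi -> natural_kmap psi ->
    (forall A x, X A x -> Y A (phi A x)) ->
    (forall A y, Y A y -> X A (psi A y)) ->
    (forall A x, psi A (phi A x) =1 x) ->
    (forall A y, phi A (psi A y) =1 y) ->
  is_isomorphism X Y phi.
Proof.
move=> phi_nat psi_nat XY YX phiK psiK; split; first by split.
by exists psi; split.
Qed.

Section Points.
Variables (F : finFieldType) (l : nat) (Delta : 'I_l -> nat) (d : nat).
Implicit Types (z : 'M[F]_(d, \sum_i Delta i)) (A : kalgebra F).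

Lemma szE z A (x : coord Delta d -> A) i :
  sz z x i = rseq (submxrow (srow x *m map_mx (kalg_str A) z) i).
Proof.
rewrite /sz; congr rseq; rewrite -mul_submxrow; congr (_ *m _).
by apply/matrixP => a b; rewrite !mxE.
Qed.

Lemma eq_sz z A (x y : coord Delta d -> A) i :
  (forall a, x (Cs a) = y (Cs a)) -> sz z x i = sz z y i.
Proof.
move=> xy; rewrite !szE (_ : srow x = srow y) //.
by apply/rowP => a; rewrite !mxE.
Qed.

(* Since t_i^N = s z^(i)_0 is a unit, the equation for u_(i,j) can be divided
   by t_i^(Nj). *)
Lemma XptE z A (x : coord Delta d -> A) :
  Xpt z x <-> forall i : 'I_l,
    [/\ x (Ct i) \is a GRing.unit, x (Ct i) ^+ #|F|.-1 = sz z x i 0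
      & forall j : 'I_(Delta i).-1,
          x (Cu i j) ^+ #|F| - x (Cu i j) = theta (kalg_str A) j.+1 (sz z x i)].
Proof.
split=> Xx i; have [t_unit t_eq u_eq] := Xx i; split=> // j; last first.
  by rewrite exprM t_eq u_eq.
apply: (mulrI (unitrX (#|F|.-1 * j.+1) t_unit)).
by rewrite u_eq /thetabar exprM t_eq.
Qed.

Lemma eq_Xpt z A (x y : coord Delta d -> A) : x =1 y -> Xpt z x -> Xpt z y.
Proof.
move=> xy /XptE Xx; apply/XptE => i; have [t_unit t_eq u_eq] := Xx i.
rewrite -(eq_sz z i (fun a => xy (Cs a))) -xy; split=> // j.
by rewrite -!xy u_eq.
Qed.

Lemma srow_Lmap g A (x : coord Delta d -> A) :
  srow (Lmap g x) = srow x *m map_mx (kalg_str A) (invmx g).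
Proof. by apply/rowP => a; rewrite mxE. Qed.

Lemma Lmap_natural g : natural_kmap (@Lmap F l Delta d g).
Proof.
move=> A B f x [i|i j|a] //=; rewrite !mxE rmorph_sum; apply: eq_bigr => b _.
by rewrite !mxE rmorphM khomP.
Qed.

Lemma LmapK g A (x : coord Delta d -> A) :
  g \in unitmx -> Lmap (invmx g) (Lmap g x) =1 x.
Proof.
move=> gU [i|i j|a] //=; rewrite srow_Lmap -mulmxA -map_mxM invmxK mulVmx //.
by rewrite map_mx1 mulmx1 mxE.
Qed.

Lemma sz_Lmap z g A (x : coord Delta d -> A) i :
  g \in unitmx -> sz (g *m z) (Lmap g x) i = sz z x i.
Proof.
by move=> gU; rewrite !szE srow_Lmap -mulmxA -map_mxM mulmxA mulVmx ?mul1mx.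
Qed.

Lemma Xpt_Lmap z g A (x : coord Delta d -> A) :
  g \in unitmx -> Xpt z x -> Xpt (g *m z) (Lmap g x).
Proof. by move=> gU Xx i; rewrite sz_Lmap //; apply: Xx. Qed.

Lemma Lmap_isomorphism z g :
  g \in unitmx -> is_isomorphism (Xvar z) (Xvar (g *m z)) (Lmap g).
Proof.
move=> gU; have gVU : invmx g \in unitmx by rewrite unitmx_inv.
apply: (inverse_kmaps_isomorphism (psi := Lmap (invmx g))).
- exact: Lmap_natural.
- exact: Lmap_natural.
- by move=> A x; apply: Xpt_Lmap.
- by move=> A y /(Xpt_Lmap gVU); rewrite mulKmx.
- by move=> A x; apply: LmapK.
- by move=> A y; rewrite -{1}[g]invmxK; apply: LmapK.
Qed.

End Points.

Section Twist.
Variables (l : nat) (Delta : 'I_l -> nat) (d : nat).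

Definition twist (A : comUnitRingType) (rho : 'I_l -> A)
    (e : forall i, 'I_(Delta i).-1 -> A) (x : coord Delta d -> A)
    (v : coord Delta d) : A :=
  match v with
  | Ct i => rho i * x (Ct i)
  | Cu i j => x (Cu i j) + e i j
  | Cs a => x (Cs a)
  end.

Definition twist_kmap (K : fieldType) (rho : 'I_l -> K)
    (e : forall i, 'I_(Delta i).-1 -> K) :
    kmap K (coord Delta d) (coord Delta d) :=
  fun A => twist (fun i => kalg_str A (rho i)) (fun i j => kalg_str A (e i j)).

Lemma twist_kmapK (K : fieldType) (rho rho' : 'I_l -> K)
    (e e' : forall i, 'I_(Delta i).-1 -> K) (A : kalgebra K)
    (x : coord Delta d -> A) :
    (forall i, rho' i * rho i = 1) -> (forall i j, e i j + e' i j = 0) ->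
  twist_kmap rho' e' (twist_kmap rho e x) =1 x.
Proof.
move=> rhoK eK [i|i j|a] //=.
  by rewrite mulrA -rmorphM rhoK rmorph1 mul1r.
by rewrite -addrA -rmorphD eK rmorph0 addr0.
Qed.

Lemma twist_kmap_natural (K : fieldType) (rho : 'I_l -> K)
    (e : forall i, 'I_(Delta i).-1 -> K) : natural_kmap (twist_kmap rho e).
Proof.
by move=> A B f x [i|i j|a] //=; rewrite ?(rmorphM f) ?(rmorphD f) khomP.
Qed.

Lemma sz_twist (F : finFieldType) (z : 'M[F]_(d, \sum_i Delta i))
    (A : kalgebra F) (rho : 'I_l -> A) (e : forall i, 'I_(Delta i).-1 -> A)
    (x : coord Delta d -> A) i :
  sz z (twist rho e x) i = sz z x i.
Proof. exact: eq_sz. Qed.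

End Twist.

Section RightTranslation.
Variables (F : finFieldType) (l : nat) (Delta : 'I_l -> nat) (d : nat).
Variables (z : 'M[F]_(d, \sum_i Delta i)) (c : forall i, 'rV[F]_(Delta i)).
Hypothesis Delta_gt0 : forall i, (0 < Delta i)%N.
Hypothesis fact_neq0 : forall i, (Delta i).-1`!%:R != 0 :> F.
Hypothesis c_neq0 : forall i, rseq (c i) 0 != 0.
Local Notation zh := (z *m \mxdiag_(i < l) bracket (c i)).

Lemma sz_mul_mxdiag (A : kalgebra F) (x : coord Delta d -> A) i k :
  (k < Delta i)%N ->
  sz zh x i k = convol (sz z x i) (kalg_str A \o rseq (c i)) k.
Proof.
move=> lt_kD; rewrite -rseq_mul_bracket // -mulmxA -map_mxM.
by rewrite -{1}[z]submxrowK mul_mxrow_mxdiag /sz mxrowK.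
Qed.

Lemma sz0_mul_mxdiag (A : kalgebra F) (x : coord Delta d -> A) i :
  sz zh x i 0 = kalg_str A (rseq (c i) 0) * sz z x i 0.
Proof. by rewrite sz_mul_mxdiag // /convol big_ord1 mulrC. Qed.

Lemma theta_sz_mul_mxdiag (A : kalgebra F) (x : coord Delta d -> A) i
    (j : 'I_(Delta i).-1) : sz z x i 0 \is a GRing.unit ->
  theta (kalg_str A) j.+1 (sz zh x i) =
  theta (kalg_str A) j.+1 (sz z x i)
  + kalg_str A (theta idfun j.+1 (rseq (c i))).
Proof.
move=> s0_unit; have lt_jD : (j.+1 < Delta i)%N by rewrite -ltn_predRL.
rewrite -(@theta_rmorph _ _ _ idfun (kalg_str A) (kalg_str A) _ _
  (kalg_str A \o rseq (c i))) ?unitfE //.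
apply: theta_convol => //; last 2 first.
- by rewrite rmorph_unit ?unitfE.
- by move=> k le_kj; apply: sz_mul_mxdiag; apply: leq_ltn_trans lt_jD.
apply: natr_dvdn_unit (dvdn_leq_fact (ltn_ord j)) _.
by rewrite -(rmorph_nat (kalg_str A)) rmorph_unit ?unitfE.
Qed.

Lemma Xpt_twist (A : kalgebra F) (rho : 'I_l -> A)
    (e : forall i, 'I_(Delta i).-1 -> A) (x : coord Delta d -> A) :
    (forall i, rho i ^+ #|F|.-1 = kalg_str A (rseq (c i) 0)) ->
    (forall i j, e i j ^+ #|F| - e i j =
       kalg_str A (theta idfun j.+1 (rseq (c i)))) ->
  Xpt zh (twist rho e x) <-> Xpt z x.
Proof.
move=> rhoE eE; have c0_unit i : kalg_str A (rseq (c i) 0) \is a GRing.unit.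
  by rewrite rmorph_unit ?unitfE.
have rho_unit i : rho i \is a GRing.unit.
  by rewrite -(unitrX_pos _ (card_finField_pred_gt0 F)) rhoE.
have t_eqE i : (twist rho e x (Ct i) ^+ #|F|.-1 == sz zh x i 0)
    = (x (Ct i) ^+ #|F|.-1 == sz z x i 0).
  by rewrite sz0_mul_mxdiag exprMn rhoE (inj_eq (mulrI (c0_unit i))).
have u_eqE i j : sz z x i 0 \is a GRing.unit ->
    (twist rho e x (Cu i j) ^+ #|F| - twist rho e x (Cu i j)
      == theta (kalg_str A) j.+1 (sz zh x i))
    = (x (Cu i j) ^+ #|F| - x (Cu i j) == theta (kalg_str A) j.+1 (sz z x i)).
  move=> s0_unit; rewrite theta_sz_mul_mxdiag // -eE /=.
  rewrite (exprDn_pchar _ _ (card_pchar_nat (kalg_str A))) opprD addrACA.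
  exact: (inj_eq (addIr _)).
split=> /XptE Xx; apply/XptE => i; have [t_unit /eqP t_eq u_eq] := Xx i.
  rewrite sz_twist t_eqE in t_eq; rewrite /= unitrM rho_unit /= in t_unit.
  split=> // [|j]; apply/eqP => //.
  by rewrite -u_eqE -?(eqP t_eq) ?unitrX // -(sz_twist zh rho e) u_eq.
rewrite sz_twist; split=> [||j]; first by rewrite /= unitrM rho_unit.
  by apply/eqP; rewrite t_eqE.
by apply/eqP; rewrite u_eqE -?(eqP t_eq) ?unitrX ?u_eq.
Qed.

Lemma twist_isomorphism (K : fieldType) (iota : {rmorphism F -> K})
    (rho : 'I_l -> K) (e : forall i, 'I_(Delta i).-1 -> K) :
    (forall i, rho i ^+ #|F|.-1 = iota (rseq (c i) 0)) ->
    (forall i j, e i j ^+ #|F| - e i j =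
       iota (theta idfun j.+1 (rseq (c i)))) ->
  is_isomorphism (base_change iota (Xvar z)) (base_change iota (Xvar zh))
    (twist_kmap (d := d) rho e).
Proof.
move=> rhoE eE; have rho_neq0 i : rho i != 0.
  have := c_neq0 i; rewrite -(fmorph_eq0 iota) -rhoE.
  by rewrite expf_eq0 card_finField_pred_gt0.
pose rhoV i := (rho i)^-1; pose eN i j := - e i j.
have twistV (A : kalgebra K) (y : coord Delta d -> A) :
    twist_kmap rho e (twist_kmap rhoV eN y) =1 y.
  by apply: twist_kmapK => [i|i j]; [exact: mulfV | exact: addNr].
have twistX (A : kalgebra K) (x : coord Delta d -> A) :
    Xpt (A := restrict iota A) zh (twist_kmap rho e x)
      <-> Xpt (A := restrict iota A) z x.
  by apply: (Xpt_twist (A := restrict iota A)) => [i|i j];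
    rewrite -rmorphXn -?rmorphB ?rhoE ?eE.
apply: (inverse_kmaps_isomorphism (psi := twist_kmap rhoV eN)).
- exact: twist_kmap_natural.
- exact: twist_kmap_natural.
- by move=> A x Xx; apply/twistX.
- by move=> A y Xy; apply/twistX; apply: eq_Xpt Xy => v; rewrite twistV.
- by move=> A x; apply: twist_kmapK => [i|i j]; [exact: mulVf | exact: addrN].
- exact: twistV.
Qed.

End RightTranslation.

Theorem theorem5p1 (F : finFieldType) (p : nat) (hp : p \in [pchar F])
    (l : nat) (Delta : 'I_l -> nat)
    (Delta_gt0 : forall i : 'I_l, (0 < Delta i)%N)
    (Delta_mono : forall i j : 'I_l, (i <= j)%N -> (Delta i <= Delta j)%N)
    (Delta_le_p : forall i : 'I_l, (Delta i <= p)%N)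
    (d : nat) (z : 'M[F]_(d, \sum_(i < l) Delta i)) :
  (forall g : 'M[F]_d, g \in unitmx ->
     is_isomorphism (Xvar z) (Xvar (g *m z)) (Lmap g)) /\
  (forall (K : finFieldType) (iota : {rmorphism F -> K})
     (root : F -> K) (r1 : K) (c : forall i : 'I_l, 'rV[F]_(Delta i)),
     #|K| = (if [forall i, Delta i == 1%N] then #|F| ^ #|F|.-1
             else #|F| ^ (p * #|F|.-1))%N ->
     Nth_root_choice iota root ->
     (* if Delta = (1, .., 1) there are no coordinates u and r1 is not used *)
     (~~ [forall i, Delta i == 1%N] -> AS_root F p r1) ->
     (forall i, Jgroup (bracket (c i))) ->
     is_isomorphism (base_change iota (Xvar z))
       (base_change iota (Xvar (z *m \mxdiag_(i < l) bracket (c i))))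
       (Rmap iota root r1 c)).
Proof.
split=> [|K iota root r1 c _ [_ rootP] r1P cJ].
  by move=> g; apply: Lmap_isomorphism.
have c_neq0 i : rseq (c i) 0 != 0 by apply: Jgroup_bracket_neq0.
pose rho i := root (rseq (c i) 0).
pose e i (j : 'I_(Delta i).-1) := iota (theta idfun j.+1 (rseq (c i))) * r1.
rewrite -[Rmap iota root r1 c]/(twist_kmap rho e).
apply: twist_isomorphism => // [i|i|i j].
- by rewrite (natr_fact_neq0 hp) // prednK.
- by have [] := rootP _ (c_neq0 i).
have [|r1E _] := r1P.
  by apply/forallPn; exists i; apply/eqP => D1; case: j => j /=; rewrite D1.
by rewrite exprMn -rmorphXn expf_card -mulrBr r1E mulr1.
Qed.
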